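(* Let $X=G/P$. For any root $\alpha\in R^+\smallsetminus R_P^+$ we have $\ell(s_\alpha W_P)\le (c_1(T_X),\alpha^\vee)-1$. Moreover, the following are equivalent: (a) The root $\alpha$ is $P$-cosmall. (b) $\ell(s_\alpha W_P)=(c_1(T_X),\alpha^\vee)-1$. (c) $(R^+\smallsetminus R_P^+)\cap s_\alpha(R_P^+)=\emptyset$, and $(\gamma,\alpha^\vee)=1$ for all $\gamma\in I(s_\alpha)\smallsetminus(R_P^+\cup\{\alpha\})$.
   Context: $G$ is a connected, simply connected, semisimple complex Lie group with $T\subset B\subset P\subset G$ a maximal torus, Borel subgroup, parabolic subgroup. $R$ is the root system, $R^+$ the positive roots, $\Delta$ the simple roots, $W$ the Weyl group, $W_P$ the Weyl group of $P$, $\Delta_P=\{\beta\in\Delta : s_\beta\in W_P\}$, $R_P^+=R^+\cap\mathbb{Z}\Delta_P$. $(-,-)$ is a $W$-invariant inner product on $\mathbb{R}\Delta$, and $\alpha^\vee=2\alpha/(\alpha,\alpha)$; $\Delta^\vee,\Delta_P^\vee$ are the coroots of $\Delta,\Delta_P$. Inversion set: $I(w)=\{\gamma\in R^+ : w(\gamma)\in -R^+\}$. Length of a coset: $\ell(wW_P)=|I(w)\smallsetminus R_P^+|$ (the length of the minimal representative of $wW_P$). Order on $\mathbb{R}\Delta$: $x\ge y$ iff $x-y$ is a non-negative linear combination of $\Delta$. $H_2(X)$ is identified with $\mathbb{Z}\Delta^\vee/\mathbb{Z}\Delta_P^\vee$, with basis the classes of $\beta^\vee$, $\beta\in\Delta\smallsetminus\Delta_P$,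 and is ordered by: $d'\le d$ iff $d-d'$ has non-negative coefficients in this basis. $H^2(X)$ is identified with $\mathbb{Z}\{\omega_\beta : \beta\in\Delta\smallsetminus\Delta_P\}$ ($\omega_\beta$ the fundamental weights), the pairing of $H^2(X)$ with $H_2(X)$ being induced by $(-,-)$. Under this identification $c_1(T_X)=\sum_{\gamma\in R^+\smallsetminus R_P^+}\gamma$. For $d\in H_2(X)$, the maximal elements (for $\le$) of $\{\alpha\in R^+\smallsetminus R_P^+ : \alpha^\vee+\mathbb{Z}\Delta_P^\vee\le d\}$ are the maximal roots of $d$. A root $\alpha\in R^+\smallsetminus R_P^+$ is $P$-cosmall if it is a maximal root of $\alpha^\vee+\mathbb{Z}\Delta_P^\vee\in H_2(X)$. *)

(* Defs.v *)
From mathcomp Require Import all_boot all_order all_algebra.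
From mathcomp Require Import finmap sesquilinear.
From mathcomp Require Import boolp classical_sets functions cardinality fsbigop.
From mathcomp Require Import reals.

Set Implicit Arguments.
Unset Strict Implicit.
Unset Printing Implicit Defensive.

Import Order.TTheory GRing.Theory Num.Theory.
Local Open Scope classical_set_scope.
Local Open Scope ring_scope.

(* The pair (T, B) enters through its root datum: V is the Euclidean space
   RΔ, Phi is R, Delta the tuple of simple roots. A parabolic subgroup P
   containing B is given by J, the set of indices of the simple roots in
   Δ_P. *)

Section RootSystem.

Context {R : realType} {V : vectType R}.
Variable form : {dot V for idfun}.

Definition coroot (a : V) : V := (2 / form a a) *: a.

(* Being orthogonal reflections, these preserve [form], so the form is
   invariant under the Weyl group they generate. *)
Definition refl (a v : V) : V := v - form v (coroot a) *: a.

Definition root_system (Phi : set V) : Prop :=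
  [/\ finite_set Phi /\ ~ Phi 0,
      forall U : {vspace V}, (forall a, Phi a -> a \in U) -> U = fullv,
      forall a b, Phi a -> Phi b -> Phi (refl a b),
      forall a b, Phi a -> Phi b -> exists m : int, form b (coroot a) = m%:~R
    & forall a (c : R), Phi a -> Phi (c *: a) -> c = 1 \/ c = -1].

Definition simple_roots (Phi : set V) n (Delta : n.-tuple V) : Prop :=
  [/\ basis_of fullv Delta,
      forall i, Phi (tnth Delta i)
    & forall a, Phi a -> exists c : 'I_n -> nat,
        a = \sum_i tnth Delta i *+ c i \/ a = - \sum_i tnth Delta i *+ c i].

Definition int_span n (v : n.-tuple V) (A : {set 'I_n}) : set V :=
  [set x | exists c : 'I_n -> int, x = \sum_(i in A) tnth v i *~ c i].

Variables (Phi : set V) (n : nat) (Delta : n.-tuple V) (J : {set 'I_n}).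

Definition root_le (x y : V) : Prop :=
  exists2 c : 'I_n -> R,
    forall i, 0 <= c i & y - x = \sum_i c i *: tnth Delta i.

Definition pos_roots : set V := [set a | Phi a /\ root_le 0 a].

Definition pos_rootsP : set V := pos_roots `&` int_span Delta J.

Definition inversions (w : V -> V) : set V :=
  [set a | pos_roots a /\ pos_roots (- w a)].

(* The length of the coset w W_P. *)
Definition coset_length (w : V -> V) : nat :=
  #|` fset_set (inversions w `\` pos_rootsP)|%fset.

(* c_1(T_X), as an element of the weight lattice. *)
Definition c1 : V := \sum_(a \in pos_roots `\` pos_rootsP) a.

Definition simple_coroots : n.-tuple V := [tuple of map coroot Delta].

(* The coset x + ZΔ_P^∨; for x in ZΔ^∨ these are the elements of H_2(X). *)
Definition H2_class (x : V) : set V :=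
  [set y | int_span simple_coroots J (y - x)].

(* Only the coefficients a i with i \notin J are coordinates in H_2(X): the
   other simple coroots have class zero. *)
Definition H2_le (d' d : set V) : Prop :=
  exists x' x (a : 'I_n -> int),
    [/\ d' = H2_class x', d = H2_class x,
        x - x' = \sum_i tnth simple_coroots i *~ a i
      & forall i, i \notin J -> 0 <= a i].

Definition roots_below (d : set V) : set V :=
  [set a | (pos_roots `\` pos_rootsP) a /\ H2_le (H2_class (coroot a)) d].

Definition maximal_root (d : set V) (a : V) : Prop :=
  roots_below d a /\ forall b, roots_below d b -> root_le a b -> b = a.

Definition cosmall (a : V) : Prop :=
  (pos_roots `\` pos_rootsP) a /\ maximal_root (H2_class (coroot a)) a.

End RootSystem.

(* Main.v *)
(* Write N for the set of positive roots outside R_P. In (c_1(T_X), a^v), the sum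
   of (g, a^v) over g in N, the terms of g and s_a(g) cancel when both lie in N.
   The remaining g in N are the inversions of s_a and the roots with s_a(g) in
   R_P^+; each contributes at least 1, and a itself contributes 2. This gives the
   inequality and the equivalence of (b) and (c).

   If (c) fails, an explicit root of N above a with coroot class at most that of
   a shows that a is not P-cosmall. Conversely, assume (c) and let b > a be
   maximal in N with the class of b^v at most that of a^v. Then both a and b are
   P-dominant, which with the maximality of b gives (a, b) > 0. By (c) the root
   s_a(b) lies in N, although its coroot b^v - (a, b^v) a^v has no positive
   coefficient outside Delta_P, a contradiction. *)

Require Import Defs.
From mathcomp Require Import all_boot all_order all_algebra.
From mathcomp Require Import finmap sesquilinear.
From mathcomp Require Import boolp classical_sets functions cardinality fsbigop.
From mathcomp Require Import reals.
From mathcomp Require Import zify ring lra.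

Set Implicit Arguments.
Unset Strict Implicit.
Unset Printing Implicit Defensive.

Import Order.TTheory GRing.Theory Num.Theory.
Local Open Scope classical_set_scope.
Local Open Scope ring_scope.

(** * Inner products, reflections and coroots *)

Section EuclideanSpace.

Context {R : realType} {V : vectType R} (form : {dot V for idfun}).
Implicit Types (a b v x y z : V) (c : R).

Lemma dotC x y : form x y = form y x.
Proof. by rewrite hermC expr0 mul1r. Qed.

Lemma dotDl x y z : form (x + y) z = form x z + form y z.
Proof. by rewrite linearDl. Qed.

Lemma dotBl x y z : form (x - y) z = form x z - form y z.
Proof. by rewrite linearBl. Qed.

Lemma dotNl x z : form (- x) z = - form x z.
Proof. by rewrite linearNl. Qed.

Lemma dotZl c x z : form (c *: x) z = c * form x z.
Proof. by rewrite linearZl_LR. Qed.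

Lemma dot0l z : form 0 z = 0.
Proof. by rewrite linear0l. Qed.

Lemma dotDr x y z : form x (y + z) = form x y + form x z.
Proof. by rewrite linearDr. Qed.

Lemma dotBr x y z : form x (y - z) = form x y - form x z.
Proof. by rewrite linearBr. Qed.

Lemma dotNr x z : form x (- z) = - form x z.
Proof. by rewrite linearNr. Qed.

Lemma dotZr c x z : form x (c *: z) = c * form x z.
Proof. by rewrite linearZr_LR. Qed.

Lemma dot_suml I (r : seq I) (P : pred I) (F : I -> V) z :
  form (\sum_(i <- r | P i) F i) z = \sum_(i <- r | P i) form (F i) z.
Proof. by rewrite linear_sumlz. Qed.

Lemma dot_sumr I (r : seq I) (P : pred I) (F : I -> V) z :
  form z (\sum_(i <- r | P i) F i) = \sum_(i <- r | P i) form z (F i).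
Proof. by rewrite linear_sumr. Qed.

Lemma dot_gt0 x : x != 0 -> 0 < form x x.
Proof. exact: neq0_dnorm_gt0. Qed.

Lemma dot_ge0 x : 0 <= form x x.
Proof.
have [->|/dot_gt0/ltW//] := eqVneq x 0; by rewrite dot0l.
Qed.

Lemma dot_eq0 x : (form x x == 0) = (x == 0).
Proof.
have [->|x0] := eqVneq x 0; first by rewrite dot0l eqxx.
by rewrite gt_eqF // dot_gt0.
Qed.


Lemma dot_coroot x a : form x (coroot form a) = 2 * form x a / form a a.
Proof. by rewrite dotZr mulrAC. Qed.

Lemma dot_corootK a : a != 0 -> form a (coroot form a) = 2.
Proof. by move=> a0; rewrite dot_coroot mulfK // dot_eq0. Qed.

Lemma dot_coroot_gt0 x a :
  a != 0 -> (0 < form x (coroot form a)) = (0 < form x a).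
Proof.
move=> /dot_gt0 a0.
by rewrite dot_coroot pmulr_lgt0 ?invr_gt0 // pmulr_rgt0.
Qed.

Lemma dot_coroot_ge0 x a :
  a != 0 -> (0 <= form x (coroot form a)) = (0 <= form x a).
Proof.
move=> /dot_gt0 a0.
by rewrite dot_coroot pmulr_lge0 ?invr_gt0 // pmulr_rge0.
Qed.

Lemma dot_coroot_lt0 x a :
  a != 0 -> (form x (coroot form a) < 0) = (form x a < 0).
Proof. by move=> a0; rewrite !ltNge dot_coroot_ge0. Qed.

Lemma corootN a : coroot form (- a) = - coroot form a.
Proof. by rewrite /coroot dotNl dotNr opprK scalerN. Qed.

Lemma refl_dot a x y :
  a != 0 -> form (refl form a x) y = form x (refl form a y).
Proof.
rewrite -dot_eq0 => a0; rewrite /refl dotBl dotBr !dotZl !dotZr.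
by rewrite (dotC a y); field.
Qed.

Lemma reflK a x : a != 0 -> refl form a (refl form a x) = x.
Proof.
move=> a0; rewrite /refl dotBl dotZl dot_corootK //.
by rewrite -addrA -opprD -scalerDl [X in X *: _](_ : _ = 0) ?scale0r ?subr0 //; ring.
Qed.

Lemma refl_self a : a != 0 -> refl form a a = - a.
Proof.
move=> a0; rewrite /refl dot_corootK // scalerDl scale1r opprD addrA subrr.
exact: add0r.
Qed.

Lemma refl_norm a x : a != 0 -> form (refl form a x) (refl form a x) = form x x.
Proof. by move=> a0; rewrite refl_dot // reflK. Qed.

Lemma coroot_refl a x : a != 0 ->
  coroot form (refl form a x) =
  coroot form x - form a (coroot form x) *: coroot form a.
Proof.
move=> a0; rewrite {1}/coroot refl_norm // /refl scalerBr scalerA.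
congr (_ - _).
by rewrite /coroot scalerA !dotZr (dotC x a); congr (_ *: _); ring.
Qed.

(** One Gram-Schmidt step per element of [A]: with y and e the residuals of [x] and [t i] relative
    to [A :\ i], subtract from y its projection on e. The family [t] may be dependent, so e = 0 is a
    separate case. *)
Lemma orthogonal_decomposition (I : finType) (t : I -> V) (A : {set I}) x :
  exists c : I -> R, forall i, i \in A ->
    form (x - \sum_(j in A) c j *: t j) (t i) = 0.
Proof.
have [m] := ubnP #|A|; elim: m A x => // m IHm A x; rewrite ltnS => leAm.
have [->|[i Ai]] := set_0Vmem A; first by exists (fun=> 0) => i; rewrite inE.
have ltA : (#|A :\ i| < m)%N by move: leAm; rewrite (cardsD1 i) Ai.
have [c yP] := IHm _ x ltA; have [d eP] := IHm _ (t i) ltA.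
set y := x - _ in yP; set e := t i - _ in eP.
pose k := form y e / form e e.
exists (fun j => if j == i then k else c j - k * d j) => j Aj.
set s := \sum_(_ in A) _.
have -> : x - s = y - k *: e.
  rewrite /s (bigD1 i) //= eqxx.
  under eq_bigr => l /andP[_ /negPf->] do rewrite scalerBl -scalerA.
  rewrite /= sumrB -scaler_sumr.
  have E (F : I -> V) : \sum_(l in A | l != i) F l = \sum_(l in A :\ i) F l.
    by apply: eq_bigl => l; rewrite !inE andbC.
  by rewrite !E /y /e scalerBr !opprD !opprK -!addrA; congr (_ + _); rewrite addrCA.
have orth l : l \in A :\ i -> form (y - k *: e) (t l) = 0.
  by move=> Al; rewrite dotBl dotZl yP // eP // mulr0 subr0.
have [ji|ji] := eqVneq j i; last by apply: orth; rewrite !inE ji.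
have -> : t j = e + \sum_(l in A :\ i) d l *: t l by rewrite ji subrK.
rewrite dotDr dot_sumr big1 ?addr0 => [|l Al]; last by rewrite dotZr orth ?mulr0.
rewrite dotBl dotZl /k.
have [->|e0] := eqVneq e 0; first by rewrite (dotC y) dot0l !mul0r subr0.
by rewrite divfK ?subrr // dot_eq0.
Qed.

(** Split the combination into its negative part q and the rest r. Dominance gives (q + r, q) <= 0
    and obtuseness gives (r, q) >= 0, so (q, q) <= 0 and q = 0; freeness then excludes negative
    coefficients. *)
Lemma dominant_coef_ge0 n (t : n.-tuple V) (A : {set 'I_n}) (c : 'I_n -> R) :
  free t ->
  {in A &, forall i j, i != j -> form (tnth t i) (tnth t j) <= 0} ->
  (forall i, i \in A -> 0 <= form (\sum_(j in A) c j *: tnth t j) (tnth t i)) ->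
  forall i, i \in A -> 0 <= c i.
Proof.
move=> freet obtuse dom i Ai; rewrite leNgt; apply/negP => ci.
pose q := \sum_(j in A | c j < 0) c j *: tnth t j.
pose r := \sum_(j in A | ~~ (c j < 0)) c j *: tnth t j.
have qr : \sum_(j in A) c j *: tnth t j = q + r.
  by rewrite (bigID (fun j => c j < 0)).
have qq : form q q <= 0.
  have -> : form q q = form (q + r) q - form r q by rewrite dotDl addrK.
  rewrite subr_le0 (@le_trans _ _ 0) //.
    rewrite /q dot_sumr; apply: sumr_le0 => j /andP[Aj cj].
    by rewrite dotZr mulr_le0_ge0 ?(ltW cj) // -qr dom.
  rewrite /q dot_sumr; apply: sumr_ge0 => j /andP[Aj cj].
  rewrite /r dot_suml; apply: sumr_ge0 => k /andP[Ak ck].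
  rewrite -leNgt in ck; rewrite dotZl dotZr mulr_ge0 // mulr_le0 ?(ltW cj) //.
  by apply: obtuse => //; apply: contraTneq ck => ->; rewrite -ltNge.
have q0 : q = 0 by apply/eqP; rewrite -dot_eq0 eq_le qq dot_ge0.
have := coord_sum_free (fun j => if (j \in A) && (c j < 0) then c j else 0) i freet.
rewrite Ai ci /= => ci0; move: ci; rewrite -ci0 -[X in coord t i X](_ : q = _).
  by rewrite q0 linear0 ltxx.
rewrite /q big_mkcond; apply: eq_bigr => j _; rewrite -tnth_nth.
by case: ifP => // _; rewrite scale0r.
Qed.

End EuclideanSpace.

(** * Simple roots, coordinates and integrality of coroots *)

Section Roots.

Context {R : realType} {V : vectType R} {form : {dot V for idfun}}.
Context {Phi : set V} {n : nat} {Delta : n.-tuple V}.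
Context (hPhi : root_system form Phi) (hDelta : simple_roots Phi Delta).
Implicit Types (a b x y : V) (i j : 'I_n).

Local Notation t := (tnth Delta).
Local Notation cf := (coord Delta).
Local Notation pos := (pos_roots Phi Delta).
Local Notation s := (refl form).
Local Notation "x ^v" := (coroot form x) (at level 2, format "x ^v").

Lemma root_neq0 a : Phi a -> a != 0.
Proof. by case: hPhi => -[_ Phi0] _ _ _ _ Pa; apply: contra_notN Phi0 => /eqP <-. Qed.

Lemma root_refl a b : Phi a -> Phi b -> Phi (s a b).
Proof. by case: hPhi => _ _ H _ _; apply: H. Qed.

Lemma opp_root a : Phi a -> Phi (- a).
Proof. by move=> Pa; rewrite -(refl_self form) ?root_neq0 //; apply: root_refl. Qed.

Lemma root_int a b : Phi a -> Phi b -> exists m : int, form b a^v = m%:~R.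
Proof. by case: hPhi => _ _ _ H _; apply: H. Qed.

Lemma root_int_ge1 a b : Phi a -> Phi b -> 0 < form b a^v -> 1 <= form b a^v.
Proof. by move=> Pa Pb; have [m ->] := root_int Pa Pb; rewrite ltr0z ler1z. Qed.

Lemma root_int_ge2 a b :
  Phi a -> Phi b -> 0 < form b a^v -> form b a^v <> 1 -> 2 <= form b a^v.
Proof.
move=> Pa Pb; have [m ->] := root_int Pa Pb; rewrite ltr0z (ler_int _ 2).
by move=> m0 m1; have : m <> 1 by [move=> E; apply: m1; rewrite E]; lia.
Qed.

(* Strict Cauchy-Schwarz bounds the product of the two Cartan integers of a
   and b by 4, so the smaller one is 1. *)
Lemma cartan_le a b : Phi a -> Phi b -> a <> b ->
  0 < form a b -> form a a <= form b b ->
  exists k : nat, [/\ (0 < k < 4)%N, form a b^v = 1, form b a^v = k%:R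
    & form b b = k%:R * form a a].
Proof.
move=> Pa Pb neq_ab ab leab.
have a0 := dot_gt0 form (root_neq0 Pa); have b0 := dot_gt0 form (root_neq0 Pb).
have [p Ep] := root_int Pb Pa; have [q Eq] := root_int Pa Pb.
have Hp : p%:~R = 2 * form a b / form b b :> R by rewrite -Ep dot_coroot.
have Hq : q%:~R = 2 * form a b / form a a :> R by rewrite -Eq dot_coroot dotC.
have p0 : 0 < p by rewrite -(ltr0z R) Hp divr_gt0 // mulr_gt0.
have q0 : 0 < q by rewrite -(ltr0z R) Hq divr_gt0 // mulr_gt0.
have CS : form a b ^+ 2 < form a a * form b b.
  pose v := a - (form a b / form b b) *: b.
  have vv : form v v = form a a - form a b ^+ 2 / form b b.
    rewrite /v dotBl !dotBr !dotZl !dotZr (dotC form b a); field; exact: lt0r_neq0.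
  have : 0 < form v v.
    apply: dot_gt0; rewrite subr_eq0; apply/eqP => Ea.
    have [_ _ _ _ red] := hPhi.
    have [||c1|cN1] := red b (form a b / form b b); rewrite -?Ea //.
      by apply: neq_ab; rewrite Ea c1 scale1r.
    by move: ab; rewrite Ea cN1 scaleN1r dotNl oppr_gt0 ltNge ltW.
  by rewrite vv subr_gt0 ltr_pdivrMr.
have pq4 : p * q < 4.
  rewrite -(ltr_int R) intrM Hp Hq.
  have -> : 2 * form a b / form b b * (2 * form a b / form a a) =
    4 * (form a b ^+ 2 / (form a a * form b b)).
    by field; rewrite !lt0r_neq0.
  by rewrite -[ltRHS]mulr1 ltr_pM2l // ltr_pdivrMr ?mul1r // mulr_gt0.
have lepq : p <= q.
  by rewrite -(ler_int R) Hp Hq ler_pM2l ?mulr_gt0 // lef_pV2.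
have p1 : p = 1 by nia.
have q4 : q < 4 by rewrite p1 mul1r in pq4.
exists `|q|%N; split.
- by lia.
- by rewrite Ep p1.
- by rewrite Eq natr_absz gtr0_norm.
- rewrite natr_absz gtr0_norm // Hq.
  have -> : 2 * form a b = form b b.
    by rewrite -[LHS](divfK (lt0r_neq0 b0)) -Hp p1 mul1r.
  by rewrite divfK // lt0r_neq0.
Qed.


Lemma coordE x : x = \sum_i cf i x *: t i.
Proof.
case: hDelta => bD _ _; rewrite {1}(coord_basis bD (memvf x)).
by apply: eq_bigr => i _; rewrite -tnth_nth.
Qed.

Lemma free_Delta : free Delta.
Proof. by case: hDelta => /basis_free. Qed.

Lemma coord_simple i j : cf i (t j) = (j == i)%:R.
Proof. by rewrite (tnth_nth 0) coord_free // free_Delta. Qed.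

Lemma coord_sum (P : pred 'I_n) (c : 'I_n -> R) i :
  cf i (\sum_(j | P j) c j *: t j) = if P i then c i else 0.
Proof.
rewrite linear_sum /=; case: ifP => Pi.
  rewrite (bigD1 i) //= linearZ /= coord_simple eqxx mulr1 big1 ?addr0 // => j.
  by case/andP=> _ /negPf ji; rewrite linearZ /= coord_simple ji mulr0.
rewrite big1 // => j Pj; rewrite linearZ /= coord_simple.
by case: eqP Pj Pi => [->->|]; rewrite ?mulr0.
Qed.

Lemma coord_inj x y : (forall i, cf i x = cf i y) -> x = y.
Proof. by move=> E; rewrite (coordE x) (coordE y); apply: eq_bigr => i _; rewrite E. Qed.

Lemma coord_refl i a x : cf i (s a x) = cf i x - form x a^v * cf i a.
Proof. by rewrite /refl linearB linearZ. Qed.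

Lemma coord_coroot i a : cf i a^v = 2 / form a a * cf i a.
Proof. by rewrite linearZ. Qed.

Lemma root_simple i : Phi (t i).
Proof. by case: hDelta. Qed.

Lemma root_leP x y : root_le Delta x y <-> forall i, cf i x <= cf i y.
Proof.
split=> [[c c0 E] i|le_xy].
  by rewrite -subr_ge0 -linearB /= E coord_sum.
exists (fun i => cf i (y - x)) => [i|]; last exact: coordE.
by rewrite linearB /= subr_ge0 le_xy.
Qed.

Lemma root_coord_nat a : Phi a -> exists c : 'I_n -> nat,
  (forall i, cf i a = (c i)%:R) \/ (forall i, cf i a = - (c i)%:R).
Proof.
case: hDelta => _ _ H /H[c Ea].
have E i : cf i (\sum_j t j *+ c j) = (c i)%:R.
  by under eq_bigr do rewrite -scaler_nat; rewrite coord_sum.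
by exists c; case: Ea => ->; [left|right] => i; rewrite ?linearN /= E.
Qed.

Lemma pos_coordP a : pos a <-> Phi a /\ forall i, 0 <= cf i a.
Proof.
split=> [[Pa /root_leP H]|[Pa H]]; split=> //.
  by move=> i; have := H i; rewrite linear0.
by apply/root_leP => i; rewrite linear0.
Qed.

Lemma pos_root a : pos a -> Phi a.
Proof. by case. Qed.

Lemma pos_coord_ge0 a i : pos a -> 0 <= cf i a.
Proof. by case/pos_coordP. Qed.

Lemma pos_of_coord i a : Phi a -> 0 < cf i a -> pos a.
Proof.
move=> Pa ai; apply/pos_coordP; split=> // j.
have [c [|] E] := root_coord_nat Pa; first by rewrite E ler0n.
by move: ai; rewrite E oppr_gt0 ltNge ler0n.
Qed.

Lemma root_coord_neq0 a : Phi a -> exists i, cf i a != 0.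
Proof.
move=> Pa; apply/existsP; apply: contraT => /existsPn H.
have /eqP[] := root_neq0 Pa; apply: coord_inj => i.
by rewrite linear0; apply/eqP; move: (H i); rewrite negbK.
Qed.

Lemma pos_coord_gt0 a : pos a -> exists i, 0 < cf i a.
Proof.
move=> pa; have [i ai] := root_coord_neq0 (pos_root pa).
by exists i; rewrite lt_def ai pos_coord_ge0.
Qed.

Lemma pos_or_neg a : Phi a -> pos a \/ pos (- a).
Proof.
move=> Pa; have [i] := root_coord_neq0 Pa; rewrite neq_lt => /orP[ai|ai].
  by right; apply: (@pos_of_coord i); rewrite ?linearN ?oppr_gt0 //; apply: opp_root.
by left; apply: (@pos_of_coord i).
Qed.

Lemma pos_not_neg a : pos a -> ~ pos (- a).
Proof.
move=> /pos_coord_gt0[i ai] /pos_coord_ge0 - /(_ i).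
by rewrite linearN oppr_ge0 leNgt ai.
Qed.

Lemma pos_simple i : pos (t i).
Proof. by apply: (@pos_of_coord i); rewrite ?coord_simple ?eqxx //; apply: root_simple. Qed.

Lemma simple_neq0 i : t i != 0.
Proof. exact: root_neq0 (root_simple i). Qed.

Lemma pos_scale a i : pos a -> (forall j, j != i -> cf j a = 0) -> a = t i.
Proof.
move=> pa H.
have Ea : a = cf i a *: t i.
  rewrite {1}(coordE a) (bigD1 i) //= big1 ?addr0 // => j ji.
  by rewrite H // scale0r.
have [_ _ _ _ red] := hPhi.
have [|| c1|cN1] := red (t i) (cf i a); rewrite -?Ea; try exact: root_simple; try exact: pos_root.
  by rewrite Ea c1 scale1r.
by have := pos_coord_ge0 i pa; rewrite cN1 oppr_ge0 ler10.
Qed.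

(** The simple reflection changes only coordinate [i]. As the root system is reduced, [a] has
    another positive coordinate, and one positive coordinate makes a root positive. *)
Lemma pos_refl_simple i a : pos a -> a <> t i -> pos (s (t i) a).
Proof.
move=> pa ai.
have [j ji aj] : exists2 j, j != i & 0 < cf j a.
  apply/exists2P; apply: contra_notP ai => /forallNP H.
  apply: (pos_scale pa) => j ji; apply/eqP; rewrite eq_le pos_coord_ge0 // andbT.
  by rewrite leNgt; apply/negP => aj; apply: (H j).
apply: (@pos_of_coord j); first exact: root_refl (root_simple i) (pos_root pa).
by rewrite coord_refl coord_simple eq_sym (negPf ji) mulr0 subr0.
Qed.

(** One of the two Cartan integers is 1, so the difference is, up to sign, a reflection of one root
    in the other. *)
Lemma root_sub a b : Phi a -> Phi b -> a <> b -> 0 < form a b -> Phi (a - b).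
Proof.
move=> Pa Pb neq_ab ab; have [le_ab|/ltW le_ba] := leP (form a a) (form b b).
  have [k [_ E _ _]] := cartan_le Pa Pb neq_ab ab le_ab.
  by have := root_refl Pb Pa; rewrite /refl E scale1r.
rewrite dotC in ab; have [k [_ E _ _]] := cartan_le Pb Pa (nesym neq_ab) ab le_ba.
by have /opp_root := root_refl Pa Pb; rewrite /refl E scale1r opprB.
Qed.

(** Otherwise [t i - t j] would be a root with coordinates of both signs. *)
Lemma simple_obtuse i j : i != j -> form (t i) (t j) <= 0.
Proof.
move=> ij; rewrite leNgt; apply/negP => tij.
have neq : t i <> t j.
  move=> E; have := coord_simple i i; rewrite {1}E coord_simple eqxx eq_sym (negPf ij).
  by move/eqP; rewrite eq_sym oner_eq0.
have Pij := root_sub (root_simple i) (root_simple j) neq tij.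
have : pos (t i - t j).
  by apply: (@pos_of_coord i) => //; rewrite linearB /= !coord_simple eqxx eq_sym (negPf ij) subr0.
move=> /pos_coord_ge0 - /(_ j).
by rewrite linearB /= !coord_simple eqxx (negPf ij) sub0r oppr_ge0 ler10.
Qed.

(** Induction on a bound for the height of a positive root b. Since (b, b) > 0 is a nonnegative
    combination of the (b, t_i), some (b, t_i) is positive; unless b = t_i, reflecting in t_i keeps
    b positive and lowers its height by at least 1. *)
Lemma coroot_int a : Phi a ->
  exists c : 'I_n -> int, a^v = \sum_i (t i)^v *~ c i.
Proof.
suff pos_case m : forall b, pos b -> \sum_i cf i b < m%:R ->
    exists c : 'I_n -> int, b^v = \sum_i (t i)^v *~ c i.
  have arch b : exists m : nat, \sum_i cf i b < m%:R.
    by exists (Num.truncn (\sum_i cf i b)).+1; apply: truncnS_gt.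
  move=> /pos_or_neg[]pa; have [m Hm] := arch (a); have [m' Hm'] := arch (- a).
    exact: pos_case pa Hm.
  have [c E] := pos_case _ _ pa Hm'; exists (fun i => - c i).
  rewrite -[a]opprK corootN E -sumrN; apply: eq_bigr => i _; by rewrite mulrNz.
elim: m => [|m IHm] b pb.
  by rewrite ltNge sumr_ge0 // => i _; apply: pos_coord_ge0.
move=> ltb; have Pb := pos_root pb.
have [i ib] : exists i, 0 < form b (t i).
  apply/existsP; apply: contraT => /existsPn H.
  have := dot_gt0 form (root_neq0 Pb); rewrite {2}(coordE b) dot_sumr ltNge.
  case/negP; apply: sumr_le0 => i _; rewrite dotZr mulr_ge0_le0 ?pos_coord_ge0 //.
  by rewrite leNgt H.
have [->|bi] := pselect (b = t i).
  exists (fun j => (j == i)%:Z); rewrite (bigD1 i) //= eqxx mulr1z big1 ?addr0 //.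
  by move=> j /negPf->; rewrite mulr0z.
have psb := pos_refl_simple pb bi.
have b1 : 1 <= form b (t i)^v.
  by apply: root_int_ge1; rewrite ?dot_coroot_gt0 ?simple_neq0 //; apply: root_simple.
have [|c Ec] := IHm _ psb.
  have -> : \sum_j cf j (s (t i) b) = \sum_j cf j b - form b (t i)^v.
    under eq_bigr do rewrite coord_refl coord_simple.
    rewrite sumrB; congr (_ - _).
    rewrite (bigD1 i) //= eqxx mulr1 big1 ?addr0 // => j ji.
    by rewrite eq_sym (negPf ji) mulr0.
  by move: ltb b1; rewrite -natr1; lra.
have [q Eq] := root_int (pos_root psb) (root_simple i).
exists (fun j => c j - q * (j == i)%:Z).
rewrite -(reflK form b (simple_neq0 i)) coroot_refl ?simple_neq0 // Eq Ec.
under [RHS]eq_bigr do rewrite mulrzBr.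
rewrite sumrB; congr (_ - _); rewrite (bigD1 i) //= eqxx mulr1 big1 ?addr0.
  by rewrite scaler_int.
by move=> j /negPf->; rewrite mulr0 mulr0z.
Qed.

Lemma coord_sum_coroot (c : 'I_n -> int) i :
  cf i (\sum_j (t j)^v *~ c j) = 2 / form (t i) (t i) * (c i)%:~R.
Proof.
under eq_bigr => j _ do rewrite -scaler_int scalerA.
by rewrite coord_sum mulrC.
Qed.

Lemma coroot_coef_ge0 (c : 'I_n -> int) i x :
  x = \sum_j (t j)^v *~ c j -> (0 <= c i) = (0 <= cf i x).
Proof.
by move=> ->; rewrite coord_sum_coroot pmulr_rge0 ?ler0z // divr_gt0 // dot_gt0 // simple_neq0.
Qed.

End Roots.

(** * Ratios of root lengths *)

Section RootLengths.

Context {R : realType} {V : vectType R} {form : {dot V for idfun}}.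
Context {Phi : set V} {n : nat} {Delta : n.-tuple V}.
Context (hPhi : root_system form Phi) (hDelta : simple_roots Phi Delta).
Implicit Types (a b x y : V) (i j : 'I_n).

Local Notation t := (tnth Delta).
Local Notation cf := (coord Delta).

(** After a change of sign of [b], [cartan_le] makes the ratio of the squared lengths a positive
    integer below 4; it is not 1 as the lengths differ. *)
Lemma nonorthogonal_norm a b : Phi a -> Phi b -> form a b != 0 ->
  form a a < form b b -> 2 * form a a <= form b b <= 3 * form a a.
Proof.
move=> Pa Pb ab ltab.
wlog ab0 : b Pb ltab ab / 0 < form a b => [H|].
  move: (ab); rewrite neq_lt => /orP[]ab'; last exact: H.
  rewrite -(opprK (form b b)) -dotNl -dotNr; apply: H.
  - exact: (opp_root hPhi).
  - by rewrite dotNl dotNr opprK.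
  - by rewrite dotNr oppr_eq0.
  - by rewrite dotNr oppr_gt0.
have neq : a <> b by move=> E; move: ltab; rewrite E ltxx.
have [k [/andP[_ k4] _ _ E]] := cartan_le hPhi Pa Pb neq ab0 (ltW ltab).
have a0 := dot_gt0 form (root_neq0 hPhi Pa).
rewrite E !ler_pM2r // !ler_nat (k4 : (k <= 3)%N) andbT ltnNge; apply/negP => k1.
by move: ltab; rewrite E ltNge ler_piMl ?lern1 // ltW.
Qed.

(* A root orthogonal to every root of the length of b only involves simple
   roots that are orthogonal to all of these: the remaining simple roots lie in
   the span of the roots of that length, so their contribution to a is
   orthogonal to itself. *)
Lemma nonorthogonal_same_norm a b i : Phi a -> Phi b ->
  cf i a != 0 -> form (t i) b != 0 ->
  exists b', [/\ Phi b', form b' b' = form b b & form a b' != 0].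
Proof.
move=> Pa Pb ai tib; apply: contrapT => H.
have {}H b' : Phi b' -> form b' b' = form b b -> form a b' = 0.
  move=> Pb' E; apply/eqP; apply: contra_notT H => ab'.
  by exists b'.
pose K j := `[< exists b', [/\ Phi b', form b' b' = form b b & form (t j) b' != 0] >].
pose x := \sum_(j | K j) cf j a *: t j.
have xH b' : Phi b' -> form b' b' = form b b -> form x b' = 0.
  move=> Pb' E; have := H b' Pb' E.
  rewrite {1}(coordE hDelta a) (bigID K) /= dotDl -/x => <-.
  rewrite [X in _ = _ + X]dot_suml [X in _ = _ + X]big1 ?addr0 // => j Kj; rewrite dotZl; apply/eqP; rewrite mulf_eq0; apply/orP; right.
  by apply: contraNT Kj => tjb'; apply/asboolP; exists b'.
have x0 : x = 0.
  apply/eqP; rewrite -(dot_eq0 form) {2}/x dot_sumr big1 // => j /asboolP[b' [Pb' E tjb']].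
  rewrite dotZr; apply/eqP; rewrite mulf_eq0; apply/orP; right; apply/eqP.
  have tj0 := simple_neq0 hPhi hDelta j.
  have := xH _ (root_refl hPhi (root_simple hDelta j) Pb').
  rewrite refl_norm // => /(_ E).
  rewrite dotBr dotZr xH // sub0r => /eqP; rewrite oppr_eq0 mulf_eq0 => /orP[|/eqP//].
  rewrite dot_coroot !mulf_eq0 pnatr_eq0 dotC (negPf tjb') invr_eq0 dot_eq0.
  by rewrite (negPf tj0).
have Ki : K i by apply/asboolP; exists b.
have := coord_sum hDelta K (fun j => cf j a) i.
by rewrite -/x x0 linear0 Ki => /eqP; rewrite eq_sym (negPf ai).
Qed.

End RootLengths.

(** * Roots outside R_P and the order on H_2(X) *)

Section Parabolic.

Context {R : realType} {V : vectType R} {form : {dot V for idfun}}.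
Context {Phi : set V} {n : nat} {Delta : n.-tuple V} {J : {set 'I_n}}.
Context (hPhi : root_system form Phi) (hDelta : simple_roots Phi Delta).
Implicit Types (a b g d x y : V) (i j : 'I_n).

Local Notation t := (tnth Delta).
Local Notation cf := (coord Delta).
Local Notation pos := (pos_roots Phi Delta).
Local Notation pos_J := (pos_rootsP Phi Delta J).
Local Notation s := (refl form).
Local Notation "x ^v" := (coroot form x) (at level 2, format "x ^v").
Local Notation class := (H2_class form Delta J).

(** Root coordinates are integers already, so membership in the span of Delta_P reduces to vanishing
    coordinates outside [J]. *)
Lemma pos_rootsPP a : pos_J a <-> pos a /\ forall i, i \notin J -> cf i a = 0.
Proof.
split=> -[pa].
  move=> [c Ea]; split=> // i iJ; rewrite Ea.
  under eq_bigr do rewrite -scaler_int.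
  by rewrite (coord_sum hDelta) (negPf iJ).
move=> a0; split=> //; have [c [|] E] := root_coord_nat hDelta (pos_root pa).
  exists (fun i => c i : int); rewrite [LHS](coordE hDelta) (bigID (fun i => i \in J)) /=.
  rewrite [X in _ + X]big1 ?addr0; last by move=> i /a0->; rewrite scale0r.
  by apply: eq_bigr => i _; rewrite E scaler_nat.
exists (fun i => - (c i : int)); rewrite [LHS](coordE hDelta) (bigID (fun i => i \in J)) /=.
rewrite [X in _ + X]big1 ?addr0; last by move=> i /a0->; rewrite scale0r.
by apply: eq_bigr => i _; rewrite E scaleNr scaler_nat mulrNz.
Qed.

Lemma nonparabolic_of_coord i a :
  Phi a -> i \notin J -> 0 < cf i a -> (pos `\` pos_J) a.
Proof.
move=> Pa iJ ai; split; first exact: (pos_of_coord hDelta Pa ai).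
by move=> /pos_rootsPP[_ /(_ i iJ) E]; rewrite E ltxx in ai.
Qed.

Lemma nonparabolic_coord a : (pos `\` pos_J) a -> exists2 i, i \notin J & 0 < cf i a.
Proof.
move=> [pa]; apply: contra_notP => H; apply/pos_rootsPP; split=> // i iJ.
apply/eqP; rewrite eq_le (pos_coord_ge0 hDelta) // andbT leNgt; apply/negP => ai.
by apply: H; exists i.
Qed.

Lemma nonparabolic_le a b :
  (pos `\` pos_J) a -> Phi b -> root_le Delta a b -> (pos `\` pos_J) b.
Proof.
move=> /nonparabolic_coord[i iJ ai] Pb /(root_leP hDelta) /(_ i) ab.
exact: nonparabolic_of_coord iJ (lt_le_trans ai ab).
Qed.

(** Other representatives of the two classes differ by elements of ZΔ_P^∨, which alter only the
    unconstrained coefficients in [J]. *)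
Lemma H2_leP x y : H2_le form Delta J (class x) (class y) <->
  exists2 c : 'I_n -> int, y - x = \sum_i (t i)^v *~ c i &
    forall i, i \notin J -> 0 <= c i.
Proof.
have tc i : tnth (simple_coroots form Delta) i = (t i)^v by rewrite tnth_map.
have spanE e : \sum_(i in J) tnth (simple_coroots form Delta) i *~ e i =
    \sum_i (t i)^v *~ (if i \in J then e i else 0).
  rewrite big_mkcond; apply: eq_bigr => i _; rewrite tc.
  by case: ifP => // _; rewrite mulr0z.
have classE u v : class u = class v -> exists e : 'I_n -> int,
    v - u = \sum_i (t i)^v *~ (if i \in J then e i else 0).
  move=> E; have : class v v.
    by exists (fun=> 0); rewrite subrr big1 // => i _; rewrite mulr0z.
  by rewrite -E => -[e ->]; exists e; rewrite spanE.
split=> [[x' [y' [c [/classE[e Ee] /classE[f Ef] E c0]]]]|[c E c0]]; last first.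
  by exists x, y, c; split=> //; rewrite E; apply: eq_bigr => i _; rewrite tc.
exists (fun i => c i + (if i \in J then e i else 0) - (if i \in J then f i else 0)).
  rewrite (_ : y - x = y' - x' + (x' - x) - (y' - y)).
    rewrite Ee Ef E -big_split -sumrB; apply: eq_bigr => i _ /=.
    by rewrite tc mulrzBr mulrzDr.
  by rewrite addrA subrK opprB [RHS]addrC addrA subrK.
by move=> i iJ; rewrite (negPf iJ) addr0 subr0 c0.
Qed.

Lemma H2_le_coord x y i : H2_le form Delta J (class x) (class y) ->
  i \notin J -> cf i x <= cf i y.
Proof.
move=> /H2_leP[c E c0] iJ; rewrite -subr_ge0 -linearB /=.
by rewrite -(coroot_coef_ge0 hPhi hDelta i E) c0.
Qed.

Lemma H2_le_refl x : H2_le form Delta J (class x) (class x).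
Proof.
apply/H2_leP; exists (fun=> 0) => //.
by rewrite subrr big1 // => i _; rewrite mulr0z.
Qed.

Lemma H2_le_coroot x d y : Phi d -> y - x = d^v ->
  (forall i, i \notin J -> 0 <= cf i d) -> H2_le form Delta J (class x) (class y).
Proof.
move=> Pd E d0; have [c Ec] := coroot_int hPhi hDelta Pd.
apply/H2_leP; exists c => [|i iJ]; first by rewrite E.
rewrite (coroot_coef_ge0 hPhi hDelta i Ec) coord_coroot mulr_ge0 ?d0 //.
by rewrite divr_ge0 // dot_ge0.
Qed.

End Parabolic.

(** * Maximal roots above a P-dominant root *)

Section Cosmall.

Context {R : realType} {V : vectType R} {form : {dot V for idfun}}.
Context {Phi : set V} {n : nat} {Delta : n.-tuple V} {J : {set 'I_n}}.
Context (hPhi : root_system form Phi) (hDelta : simple_roots Phi Delta).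
Implicit Types (a b g d x y : V) (i j : 'I_n).

Local Notation t := (tnth Delta).
Local Notation cf := (coord Delta).
Local Notation pos := (pos_roots Phi Delta).
Local Notation pos_J := (pos_rootsP Phi Delta J).
Local Notation s := (refl form).
Local Notation "x ^v" := (coroot form x) (at level 2, format "x ^v").
Local Notation class := (H2_class form Delta J).
Local Notation "x <=H y" := (H2_le form Delta J (class x^v) (class y^v)) (at level 70).

(** If b were not longer than a, comparing coroot coordinates outside [J] would force b and a to
    agree there. Then b - a is a nonnegative combination of simple roots in [J], so (b - a, a) >= 0
    and (a, b) >= (a, a) > 0. *)
Lemma maximal_below_norm a b :
  (pos `\` pos_J) a -> (forall i, i \in J -> 0 <= form (t i) a) ->
  root_le Delta a b -> pos b -> b <=H a -> form a b <= 0 -> form a a < form b b.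
Proof.
move=> Na dom /(root_leP hDelta) ab pb ba ab0; rewrite ltNge; apply/negP => leba.
have a0 := dot_gt0 form (root_neq0 hPhi (pos_root Na.1)).
have b0 := dot_gt0 form (root_neq0 hPhi (pos_root pb)).
have E i : i \notin J -> cf i (b - a) = 0.
  move=> iJ; apply/eqP; rewrite linearB subr_eq0 eq_le ab andbT /=.
  have := H2_le_coord hPhi hDelta ba iJ; rewrite !coord_coroot.
  rewrite -!mulrA ler_pM2l // ler_pdivrMl // mulrCA ler_pdivlMl // => H.
  rewrite -(ler_pM2l a0); apply: le_trans H _.
  by rewrite ler_wpM2r // (pos_coord_ge0 hDelta i Na.1).
have : 0 <= form (b - a) a.
  rewrite (coordE hDelta (b - a)) dot_suml sumr_ge0 // => i _; rewrite dotZl.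
  have [iJ|/E->] := boolP (i \in J); last by rewrite mul0r.
  by rewrite mulr_ge0 ?dom // linearB /= subr_ge0 ab.
by rewrite dotBl subr_ge0 dotC => /(lt_le_trans a0); rewrite ltNge ab0.
Qed.

(** If (t_i, b) < 0, the reflection of b in t_i lies strictly above b. The condition on [c i] keeps
    its class below that of a^v, against maximality; for i in [J] the class does not change. *)
Lemma maximal_below_simple a b i :
  (pos `\` pos_J) b ->
  (forall x, (pos `\` pos_J) x -> root_le Delta b x -> x <=H a -> x = b) ->
  forall c : 'I_n -> int, a^v - b^v = \sum_j (t j)^v *~ c j ->
  (forall j, j \notin J -> 0 <= c j) ->
  i \in J \/ 0 <= (c i)%:~R + form (t i) b^v -> 0 <= form (t i) b.
Proof.
move=> Nb maxb c E c0 ci; rewrite leNgt; apply/negP => tib.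
have Pb := pos_root Nb.1; have ti0 := simple_neq0 hPhi hDelta i.
have m0 : form b (t i)^v < 0.
  by rewrite dot_coroot_lt0 // dotC.
have le_b : root_le Delta b (s (t i) b).
  apply/(root_leP hDelta) => j; rewrite coord_refl lerDl oppr_ge0.
  by rewrite (coord_simple hDelta) nmulr_rle0.
have Px := root_refl hPhi (root_simple hDelta i) Pb.
have Nx := nonparabolic_le hDelta Nb Px le_b.
have [q Eq] := root_int hPhi Pb (root_simple hDelta i).
have /maxb : s (t i) b <=H a.
  apply/H2_leP; exists (fun j => c j + q * (j == i)%:Z).
    rewrite coroot_refl // Eq opprB addrC -addrA addrC (addrC (- _)) E.
    under [RHS]eq_bigr do rewrite mulrzDr.
    rewrite big_split /=; congr (_ + _); rewrite (bigD1 i) //= eqxx mulr1 big1 ?addr0.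
      by rewrite scaler_int.
    by move=> j /negPf->; rewrite mulr0 mulr0z.
  move=> j jJ; have [ji|ji] := eqVneq j i; last by rewrite mulr0 addr0 c0.
  rewrite mulr1 -(ler0z R) intrD -Eq ji; case: ci => // iJ.
  by rewrite -ji (negPf jJ) in iJ.
move=> /(_ Nx le_b) /eqP; rewrite /refl -subr_eq0 addrAC subrr sub0r oppr_eq0.
by rewrite scaler_eq0 (negPf ti0) orbF => /eqP E0; rewrite E0 ltxx in m0.
Qed.

(* If (a, b) <= 0 then b is longer than a. Any simple root t_i that obstructs
   the dominance of b while occurring in a^v - b^v would be longer than b, which
   gives three root lengths in the component of a. *)
Lemma maximal_below_dominant a b (c : 'I_n -> int) i :
  (pos `\` pos_J) a -> (pos `\` pos_J) b ->
  (forall x, (pos `\` pos_J) x -> root_le Delta b x -> x <=H a -> x = b) ->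
  form a a < form b b ->
  a^v - b^v = \sum_j (t j)^v *~ c j -> (forall j, j \notin J -> 0 <= c j) ->
  i \notin J -> 0 < c i -> 0 <= form (t i) b.
Proof.
move=> Na Nb maxb ltab E c0 iJ ci; rewrite leNgt; apply/negP => tib.
have Pa := pos_root Na.1; have Pb := pos_root Nb.1; have Pt := root_simple hDelta i.
have neq : t i <> - b.
  by move=> tb; apply: (pos_not_neg hPhi hDelta Nb.1); rewrite -tb; apply: pos_simple.
have tNb : 0 < form (t i) (- b) by rewrite dotNr oppr_gt0.
(* If t_i is not longer than b, then (t_i, b^v) = -1, which [c i] >= 1 compensates. *)
have [le_tb|lt_bt] := leP (form (t i) (t i)) (form b b).
  have [|k [_ E1 _ _]] := cartan_le hPhi Pt (opp_root hPhi Pb) neq tNb.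
    by rewrite dotNl dotNr opprK.
  have : form (t i) b^v = -1 by rewrite -E1 corootN dotNr opprK.
  move=> Etb; suff : 0 <= form (t i) b by rewrite leNgt tib.
  apply: (maximal_below_simple Nb maxb E c0); right.
  by rewrite Etb subr_ge0 (ler_int _ 1).
have ai : cf i a != 0.
  suff : 0 < cf i a^v.
    rewrite coord_coroot => ai; apply: contraTneq ai => ->.
    by rewrite mulr0 ltxx.
  have := coord_sum_coroot hDelta c i (form := form).
  rewrite -E linearB /= => /eqP; rewrite subr_eq => /eqP ->.
  rewrite ltr_wpDr // ?coord_coroot.
    by rewrite mulr_ge0 ?divr_ge0 ?dot_ge0 // (pos_coord_ge0 hDelta i Nb.1).
  by rewrite mulr_gt0 ?ltr0z // divr_gt0 // dot_gt0 // (simple_neq0 hPhi hDelta).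
have tt : form (t i) (t i) != 0 by rewrite dot_eq0 (simple_neq0 hPhi hDelta).
(* Roots [b1] and [b2] of the lengths of t_i and b, not orthogonal to a, make the lengths
   comparable: (b, b) >= 2 (a, a) and (t_i, t_i) >= 2 (b, b) contradict (t_i, t_i) <= 3 (a, a). *)
have [b1 [P1 E1 ab1]] := nonorthogonal_same_norm hPhi hDelta Pa Pt ai tt.
have [b2 [P2 E2 ab2]] := nonorthogonal_same_norm hPhi hDelta Pa Pb ai (negbT (lt_eqF tib)).
have := nonorthogonal_norm hPhi Pa P1 ab1; rewrite E1 => /(_ (lt_trans ltab lt_bt)).
have := nonorthogonal_norm hPhi Pa P2 ab2; rewrite E2 => /(_ ltab).
have := nonorthogonal_norm hPhi Pb Pt _ lt_bt; rewrite dotC => /(_ (negbT (lt_eqF tib))).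
have := dot_gt0 form (root_neq0 hPhi Pa).
lra.
Qed.

(* Modulo the span of the simple roots in J, b is orthogonally projected to b0.
   Then (a^v, b0) >= (b^v, b0) > 0, and the part b - b0 is a nonnegative
   combination of the simple roots in J, on which a is dominant. *)
Lemma maximal_below_acute a b :
  (pos `\` pos_J) a -> (forall i, i \in J -> 0 <= form (t i) a) ->
  (pos `\` pos_J) b -> root_le Delta a b -> b <=H a ->
  (forall x, (pos `\` pos_J) x -> root_le Delta b x -> x <=H a -> x = b) ->
  0 < form a b.
Proof.
move=> Na dom Nb ab ba maxb; rewrite ltNge; apply/negP => ab0.
have Pa := pos_root Na.1; have Pb := pos_root Nb.1.
have ltab := maximal_below_norm Na dom ab Nb.1 ba ab0.
have a0 := dot_gt0 form (root_neq0 hPhi Pa); have b0 := dot_gt0 form (root_neq0 hPhi Pb).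
have /H2_leP[c E c0] := ba.
have domb i : i \in J -> 0 <= form (t i) b.
  by move=> iJ; apply: (maximal_below_simple Nb maxb E c0); left.
have [e orth] := orthogonal_decomposition form t J b.
set p := \sum_(j in J) _ in orth; set b' := b - p in orth.
have orthp : form b' p = 0.
  by rewrite dot_sumr big1 // => i iJ; rewrite dotZr orth ?mulr0.
(* As b' is orthogonal to the simple roots in [J], p pairs with them as b does, hence
   nonnegatively. *)
have e0 : forall i, i \in J -> 0 <= e i.
  apply: (dominant_coef_ge0 (form := form) (free_Delta hDelta)) => [i j _ _|i iJ].
    exact: (simple_obtuse hPhi hDelta).
  by have := domb i iJ; rewrite -[b](subrK p) dotDr (dotC _ _ b') orth // add0r dotC.
have pa : 0 <= form a p.
  by rewrite dot_sumr sumr_ge0 // => i iJ; rewrite dotZr mulr_ge0 ?e0 // dotC dom.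
have b'0 : b' != 0.
  have [i iJ bi] := nonparabolic_coord hDelta Nb.
  apply: contraTneq bi => /eqP; rewrite subr_eq0 => /eqP ->.
  by rewrite (coord_sum hDelta) (negPf iJ) ltxx.
have bb' : 0 < form b^v b'.
  rewrite dotZl mulr_gt0 ?divr_gt0 // -[b](subrK p) dotDl (dotC _ p) orthp addr0.
  exact: dot_gt0.
(* Terms in [J] vanish by orthogonality. For the others with [c i] > 0, (t_i, b) >= 0 while (t_i, p)
   <= 0 by obtuseness. *)
have : 0 <= form (a^v - b^v) b'.
  rewrite E dot_suml sumr_ge0 // => i _; rewrite -scaler_int scalerA dotZl.
  have [iJ|iJ] := boolP (i \in J); first by rewrite dotC orth ?mulr0.
  have := c0 i iJ; rewrite le_eqVlt => /orP[/eqP<-|ci]; first by rewrite !mul0r.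
  rewrite mulr_ge0 //; first by rewrite mulr_ge0 ?ler0z ?c0 // divr_ge0 // dot_ge0.
  rewrite dotBr subr_ge0 (@le_trans _ _ 0) //.
    rewrite dot_sumr sumr_le0 // => j jJ; rewrite dotZr mulr_ge0_le0 ?e0 //.
    by apply: (simple_obtuse hPhi hDelta) => //; apply: contraNneq iJ => ->.
  exact: (maximal_below_dominant Na Nb maxb ltab E c0 iJ ci).
rewrite dotBl subr_ge0 => /(lt_le_trans bb').
rewrite dotZl pmulr_rgt0 ?divr_gt0 // => ab'.
by move: ab0; rewrite -[b](subrK p) dotDr leNgt ltr_wpDr.
Qed.

End Cosmall.

(** * Existence of maximal roots and criteria for being P-cosmall *)

Lemma seq_max {R : realType} (T : eqType) (P : T -> Prop) (f : T -> R) (r : seq T) :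
  (exists2 x, x \in r & P x) ->
  exists x, [/\ x \in r, P x & forall y, y \in r -> P y -> f y <= f x].
Proof.
elim: r => [|z r IHr]; first by case.
move=> [x0 x0r Px0]; have [[x xr Px]|noP] := pselect (exists2 x, x \in r & P x); last first.
  exists x0; split=> // y; rewrite inE => /predU1P[->|yr Py]; last by case: noP; exists y.
  move: x0r; rewrite inE => /predU1P[->//|x0r]; case: noP; by exists x0.
have [|{Px xr}x [xr Px maxx]] := IHr; first by exists x.
have [Pz|nPz] := pselect (P z /\ f x <= f z).
  exists z; split=> [||y]; rewrite ?mem_head //; first by case: Pz.
  rewrite inE => /predU1P[->//|yr Py]; case: Pz => _; exact/le_trans/maxx.
exists x; split=> [||y]; rewrite ?inE ?xr ?orbT //.
move=> /predU1P[-> Pz|yr]; last exact: maxx.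
by rewrite leNgt; apply/negP => /ltW xz; apply: nPz.
Qed.

Section Characterization.

Context {R : realType} {V : vectType R} {form : {dot V for idfun}}.
Context {Phi : set V} {n : nat} {Delta : n.-tuple V} {J : {set 'I_n}}.
Context (hPhi : root_system form Phi) (hDelta : simple_roots Phi Delta).
Implicit Types (a b g d x y : V) (i j : 'I_n).

Local Notation t := (tnth Delta).
Local Notation cf := (coord Delta).
Local Notation pos := (pos_roots Phi Delta).
Local Notation pos_J := (pos_rootsP Phi Delta J).
Local Notation s := (refl form).
Local Notation "x ^v" := (coroot form x) (at level 2, format "x ^v").
Local Notation class := (H2_class form Delta J).
Local Notation "x <=H y" := (H2_le form Delta J (class x^v) (class y^v)) (at level 70).

Lemma root_le_height x y : root_le Delta x y ->
  \sum_i cf i y <= \sum_i cf i x -> y = x.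
Proof.
move=> /(root_leP hDelta) le_xy le_yx; apply: (coord_inj hDelta) => i.
have : \sum_i (cf i y - cf i x) == 0.
  by rewrite eq_le sumr_ge0 ?andbT ?sumrB ?subr_le0 // => j _; rewrite subr_ge0.
rewrite psumr_eq0 => [/allP/(_ i (mem_index_enum _))|j _]; last by rewrite subr_ge0.
by rewrite subr_eq0 => /eqP.
Qed.

(** There are finitely many roots, and one of greatest height among the candidates is maximal, since
    comparable elements of equal height coincide. *)
Lemma exists_maximal_below a b : (pos `\` pos_J) b -> b <=H a ->
  exists x, [/\ (pos `\` pos_J) x, root_le Delta b x, x <=H a &
    forall y, (pos `\` pos_J) y -> root_le Delta x y -> y <=H a -> y = x].
Proof.
move=> Nb ba; have [[/finite_seqP[r Er] _] _ _ _ _] := hPhi.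
have inr x : (pos `\` pos_J) x -> x \in r by case=> -[]; rewrite Er.
have [|x [_ [Nx bx xa] maxx]] :=
    @seq_max _ _ (fun x => [/\ (pos `\` pos_J) x, root_le Delta b x & x <=H a])
      (fun x => \sum_i cf i x) r.
  by exists b; [exact: inr|split=> //; apply/(root_leP hDelta)].
exists x; split=> // y Ny xy ya; apply: (root_le_height xy); apply: maxx; first exact: inr.
split=> //; apply/(root_leP hDelta) => i.
by move: bx xy => /(root_leP hDelta)/(_ i) bx /(root_leP hDelta)/(_ i); apply: le_trans.
Qed.

(** If (g, a^v) <= 0, then s_a(g) is g plus a nonnegative multiple of a, so it has no negative
    coordinate. *)
Lemma inversion_dot_gt0 a g : pos a -> pos g -> pos (- s a g) -> 0 < form g a^v.
Proof.
move=> pa pg psg; rewrite ltNge; apply/negP => ga.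
have [i] := pos_coord_gt0 hPhi hDelta psg.
rewrite linearN oppr_gt0 /= coord_refl ltNge; apply/negP; rewrite negbK.
by rewrite subr_ge0 (@le_trans _ _ 0) ?(pos_coord_ge0 hDelta i pg) // mulr_le0_ge0 // (pos_coord_ge0 hDelta i pa).
Qed.

Lemma cosmallI a : (pos `\` pos_J) a ->
  (forall d, pos_J d -> 0 <= form d a^v) ->
  (forall g, (pos `\` pos_J) g -> g <> a -> pos (- s a g) -> form g a^v = 1) ->
  (forall g, (pos `\` pos_J) g -> ~ pos_J (s a g)) ->
  cosmall form Phi Delta J a.
Proof.
move=> Na dom inv1 out; split=> //; split; first by split=> //; apply: H2_le_refl.
move=> b0 [Nb0 b0a] ab0; apply: contrapT => neq0.
have [b [Nb b0b ba maxb]] := exists_maximal_below Nb0 b0a.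
have Pa := pos_root Na.1; have Pb := pos_root Nb.1; have a_neq0 := root_neq0 hPhi Pa.
have ab : root_le Delta a b.
  apply/(root_leP hDelta) => i.
  by move: ab0 b0b => /(root_leP hDelta)/(_ i) ab0 /(root_leP hDelta)/(_ i); apply: le_trans.
have neq : b <> a.
  move=> E; apply: neq0; apply: (root_le_height ab0); rewrite -E ler_sum // => i _.
  by move/(root_leP hDelta): b0b.
have doma i : i \in J -> 0 <= form (t i) a.
  move=> iJ; rewrite -dot_coroot_ge0 //; apply: dom; apply/(pos_rootsPP hDelta).
  split=> [|j jJ]; first exact: pos_simple.
  rewrite (coord_simple hDelta); case: eqP => // E.
  by rewrite -E iJ in jJ.
have acute := maximal_below_acute hPhi hDelta Na doma Nb ab ba maxb.
have ba1 : 1 <= form b a^v by apply: (root_int_ge1 hPhi); rewrite ?dot_coroot_gt0 // dotC.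
have ab1 : 1 <= form a b^v.
  by apply: (root_int_ge1 hPhi); rewrite ?dot_coroot_gt0 // (root_neq0 hPhi).
have Psb := root_refl hPhi Pa Pb.
(* Otherwise b is an inversion, so (b, a^v) = 1 and s_a(b) = b - a, which has nonnegative
   coordinates. *)
have psb : pos (s a b).
  have [//|psNb] := pos_or_neg hPhi hDelta Psb.
  have [i] := pos_coord_gt0 hPhi hDelta psNb.
  rewrite linearN oppr_gt0 /= coord_refl (inv1 _ Nb neq psNb) mul1r subr_lt0 ltNge.
  by move: ab => /(root_leP hDelta) ->.
have Nsb : (pos `\` pos_J) (s a b) by split=> //; apply: out.
have [i iJ] := nonparabolic_coord hDelta Nsb.
have ca : 0 <= cf i a^v.
  by rewrite coord_coroot mulr_ge0 ?divr_ge0 ?dot_ge0 // (pos_coord_ge0 hDelta i Na.1).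
(* The coroot is b^v - (a, b^v) a^v, where (a, b^v) >= 1 and b^v is at most a^v in coordinate
   [i]. *)
have : cf i (s a b)^v <= 0.
  rewrite coroot_refl // linearB [X in _ - X]linearZ /= subr_le0.
  apply: le_trans (H2_le_coord hPhi hDelta ba iJ) _.
  by rewrite ler_peMl.
rewrite coord_coroot pmulr_rle0; first by move=> /le_lt_trans H /H; rewrite ltxx.
by rewrite divr_gt0 // dot_gt0 // (root_neq0 hPhi).
Qed.

(** If (d, a^v) < 0, then s_d(a) lies strictly above a, and its coroot has the class of a^v because
    d^v lies in ZΔ_P^∨. This contradicts maximality. *)
Lemma cosmall_dominant a d :
  cosmall form Phi Delta J a -> pos_J d -> 0 <= form d a^v.
Proof.
move=> [Na [_ maxa]] /(pos_rootsPP hDelta)[pd dJ]; rewrite leNgt; apply/negP => da.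
have Pa := pos_root Na.1; have Pd := pos_root pd.
have a0 := root_neq0 hPhi Pa; have d0 := root_neq0 hPhi Pd.
have ad : form a d^v < 0.
  by rewrite dot_coroot_lt0 // dotC -(dot_coroot_lt0 form _ a0).
have le_a : root_le Delta a (s d a).
  apply/(root_leP hDelta) => i; rewrite coord_refl lerDl oppr_ge0.
  by rewrite mulr_le0_ge0 ?(ltW ad) // (pos_coord_ge0 hDelta i pd).
have Nx := nonparabolic_le hDelta Na (root_refl hPhi Pd Pa) le_a.
have /maxa : roots_below form Phi Delta J (class a^v) (s d a).
  split=> //; apply/H2_leP.
  have [m Em] := root_int hPhi Pa Pd; have [c Ec] := coroot_int hPhi hDelta Pd.
  exists (fun i => c i * m).
    rewrite coroot_refl // opprB addrC subrK Em scaler_int Ec mulrz_suml.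
    by apply: eq_bigr => i _; rewrite mulrzA.
  move=> i iJ; suff -> : c i = 0 by rewrite mul0r.
  apply/eqP; rewrite -(intr_eq0 R); have := coord_sum_coroot hDelta c i (form := form).
  rewrite -Ec coord_coroot dJ // mulr0 => /esym/eqP; rewrite !mulf_eq0 invr_eq0.
  by rewrite pnatr_eq0 dot_eq0 (negPf (simple_neq0 hPhi hDelta i)).
move=> /(_ le_a) /eqP; rewrite /refl -subr_eq0 addrAC subrr sub0r oppr_eq0.
by rewrite scaler_eq0 (negPf d0) orbF lt_eqF.
Qed.

(* If (g, a^v) = k >= 2, then d := - s_a(g) satisfies g + d = k a and
   g^v + d^v = a^v. As (a - g) + (a - d) = (2 - k) a is not positive, one of the
   roots g, d lies above a, contradicting the maximality of a. *)
Lemma cosmall_inversion a g :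
  cosmall form Phi Delta J a -> (pos `\` pos_J) g -> g <> a -> pos (- s a g) ->
  form g a^v = 1.
Proof.
move=> [Na [_ maxa]] Ng neq pd; apply: contrapT => ga1.
have Pa := pos_root Na.1; have Pg := pos_root Ng.1; have Pd := pos_root pd.
have a0 := root_neq0 hPhi Pa; have g0 := root_neq0 hPhi Pg.
have ga_gt0 := inversion_dot_gt0 Na.1 Ng.1 pd.
have ga2 := root_int_ge2 hPhi Pa Pg ga_gt0 ga1.
have ga : 0 < form g a by rewrite -(dot_coroot_gt0 form _ a0).
(* One of the two Cartan integers is 1, and (g, a^v) is not. *)
have ag1 : form a g^v = 1.
  have [le_ag|/ltW le_ga] := leP (form a a) (form g g).
    by rewrite dotC in ga; have [k []] := cartan_le hPhi Pa Pg (nesym neq) ga le_ag.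
  by have [k []] := cartan_le hPhi Pg Pa neq ga le_ga.
set d := - s a g in pd Pd.
have Ed : d^v = a^v - g^v.
  by rewrite corootN coroot_refl // ag1 scale1r opprB.
have neqd : d <> a.
  move=> E; apply: neq; rewrite -[g](reflK form _ a0) -[s a g]opprK -/d E.
  by rewrite /refl dotNl dot_corootK // scaleNr opprK scaler_nat addrC mulr2n addrK.
have da : 0 < form d a.
  rewrite -(dot_coroot_gt0 form _ a0) dotNl oppr_gt0 dotBl dotZl dot_corootK //.
  by move: ga2; lra.
have below x y : Phi y -> pos y -> x^v = a^v - y^v -> x <=H a.
  move=> Py py Ex; apply: (H2_le_coroot hPhi hDelta Py).
    by rewrite Ex opprB addrCA subrr addr0.
  by move=> i _; apply: (pos_coord_ge0 hDelta).
(* Since (a, x) > 0, a - x is a root; were it negative, x would lie above a and maximality would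
   give x = a. *)
have not_above x : Phi x -> x <> a -> 0 < form x a -> x <=H a -> pos (a - x).
  move=> Px neqx xa le_xa.
  have Pax : Phi (a - x) by apply: (root_sub hPhi) => //; [exact: nesym|rewrite dotC].
  have [//|] := pos_or_neg hPhi hDelta Pax.
  rewrite opprB => pxa; case: neqx; apply: maxa.
    split=> //; apply: (nonparabolic_le hDelta Na Px).
    apply/(root_leP hDelta) => i; rewrite -subr_ge0 -linearB.
    exact: (pos_coord_ge0 hDelta).
  apply/(root_leP hDelta) => i; rewrite -subr_ge0 -linearB.
  exact: (pos_coord_ge0 hDelta).
have pag : pos (a - g).
  apply: not_above => //; apply: (below _ d) => //.
  by rewrite Ed opprB addrCA subrr addr0.
have pad : pos (a - d).
  apply: not_above => //; apply: (below _ g) => //; exact: Ng.1.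
have [i agi] := pos_coord_gt0 hPhi hDelta pag.
have := pos_coord_ge0 hDelta i pad; have := pos_coord_ge0 hDelta i Na.1.
move: agi; rewrite !linearB linearN /= coord_refl.
nra.
Qed.

End Characterization.

(** * The degree minus the length as a sum of nonnegative terms *)

Section Length.

Context {R : realType} {V : vectType R} {form : {dot V for idfun}}.
Context {Phi : set V} {n : nat} {Delta : n.-tuple V} {J : {set 'I_n}}.
Context (hPhi : root_system form Phi) (hDelta : simple_roots Phi Delta).
Implicit Types (a x y : V).

Local Notation pos := (pos_roots Phi Delta).
Local Notation pos_J := (pos_rootsP Phi Delta J).
Local Notation s := (refl form).
Local Notation "x ^v" := (coroot form x) (at level 2, format "x ^v").
Local Notation inv := (inversions Phi Delta).

Lemma inversion_self a : pos a -> inv (s a) a.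
Proof. by move=> pa; split=> //; rewrite refl_self ?opprK // (root_neq0 hPhi) //; case: pa. Qed.

(* The terms of [form (c1 Phi Delta J) a^v] at x and s_a x cancel whenever both
   belong to the index set. *)
Lemma degree_length_sum a : (pos `\` pos_J) a -> exists M : seq V,
  (forall x, x \in M <-> (pos `\` pos_J) x /\ ~ (pos `\` pos_J) (s a x)) /\
  form (c1 Phi Delta J) a^v - 1 - (coset_length Phi Delta J (s a))%:R =
  \sum_(x <- M) (form x a^v - `[< inv (s a) x >]%:R - (x == a)%:R).
Proof.
move=> Na; have Pa := pos_root Na.1; have a0 := root_neq0 hPhi Pa.
have finPhi : finite_set Phi by case: hPhi => -[].
have finN : finite_set (pos `\` pos_J) by apply: sub_finite_set finPhi => x [[]].
have finI : finite_set (inv (s a) `\` pos_J) by apply: sub_finite_set finPhi => x [[[]]].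
set N := fset_set (pos `\` pos_J); set I := fset_set (inv (s a) `\` pos_J).
have inN x : x \in N <-> (pos `\` pos_J) x by rewrite in_fset_set // in_setE.
have inI x : x \in I <-> (inv (s a) `\` pos_J) x by rewrite in_fset_set // in_setE.
pose M := [seq x <- N | s a x \notin N].
have inM x : x \in M <-> (pos `\` pos_J) x /\ ~ (pos `\` pos_J) (s a x).
  rewrite mem_filter -inN -inN; split=> [/andP[/negP]|[-> /negP ->]] //.
exists M; split=> //.
have uniqM : uniq M by rewrite filter_uniq // fset_uniq.
have deg : form (c1 Phi Delta J) a^v = \sum_(x <- M) form x a^v.
  rewrite /c1 fsbig_finite //= dot_suml (bigID (fun x => s a x \in N)) /=.
  rewrite -[X in X + _]big_filter -[X in _ + X]big_filter.
  set L := [seq x <- N | s a x \in N].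
  (* [L] is stable under s_a, which negates the pairing with a^v. *)
  suff : \sum_(x <- L) form x a^v = - \sum_(x <- L) form x a^v.
    by move=> E; rewrite (_ : \sum_(x <- L) _ = 0) ?add0r //; lra.
  have E : perm_eq L (map (s a) L).
    have injs : injective (s a) := can_inj (fun x => reflK form x a0).
    apply: uniq_perm; rewrite ?map_inj_uniq ?filter_uniq ?fset_uniq // => x.
    rewrite -{2}[x](reflK form _ a0) mem_map // !mem_filter reflK //.
    by rewrite andbC.
  rewrite {1}(perm_big _ E) big_map -sumrN; apply: eq_bigr => x _.
  by rewrite /refl dotBl dotZl dot_corootK //; ring.
(* An inversion outside R_P belongs to [M], since its image under s_a is negative. *)
have len : (coset_length Phi Delta J (s a))%:R = \sum_(x <- M) `[< inv (s a) x >]%:R :> R.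
  rewrite /coset_length -/I -natr_sum -sum1_size; congr _%:R.
  rewrite -[RHS]big_mkcond /= -[RHS]big_filter; apply: perm_big; apply: uniq_perm.
  - exact: fset_uniq.
  - exact: filter_uniq.
  move=> x; rewrite mem_filter; apply/idP/andP => [/inI[Ix nJ]|[/asboolP Ix /inM[[_ nJ] _]]].
    split; first exact/asboolP.
    apply/inM; case: Ix => px psx; split=> // -[/(pos_not_neg hPhi hDelta)].
    exact.
  exact/inI.
have self : \sum_(x <- M) (x == a)%:R = 1 :> R.
  have aM : a \in M.
    apply/inM; split=> // -[/(pos_not_neg hPhi hDelta)]; case: (inversion_self Na.1).
    by [].
  rewrite (bigD1_seq a) //= eqxx big1 ?addr0 // => x /negPf -> //.
by rewrite !sumrB deg len self addrAC.
Qed.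

(** Either s_a(x) is negative, or it lies in R_P^+. In the latter case a positive coordinate of x
    outside [J] drops to 0 on subtracting (x, a^v) a, so (x, a^v) > 0. Integrality gives the bound
    1. *)
Lemma nonparabolic_moved_dot a x : (pos `\` pos_J) a ->
  (pos `\` pos_J) x -> ~ (pos `\` pos_J) (s a x) ->
  1 <= form x a^v /\ (inv (s a) x \/ pos_J (s a x)).
Proof.
move=> Na Nx Nsx; have Pa := pos_root Na.1; have Px := pos_root Nx.1.
suff [x0 ?] : 0 < form x a^v /\ (inv (s a) x \/ pos_J (s a x)).
  by split=> //; apply: (root_int_ge1 hPhi).
have [psx|nsx] := pos_or_neg hPhi hDelta (root_refl hPhi Pa Px); last first.
  by split; [apply: (inversion_dot_gt0 hPhi hDelta) Na.1 Nx.1 nsx|left; split=> //; exact: Nx.1].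
have Jsx : pos_J (s a x) by apply: contrapT => nJ; apply: Nsx.
split; last by right.
have [i iJ xi] := nonparabolic_coord hDelta Nx.
have /(pos_rootsPP hDelta)[_ /(_ i iJ)] := Jsx.
rewrite coord_refl => /eqP; rewrite subr_eq0 => /eqP E.
rewrite ltNge; apply/negP => x0; move: xi; rewrite E ltNge.
by rewrite mulr_le0_ge0 // (pos_coord_ge0 hDelta i Na.1).
Qed.

(** At x = a the pairing is 2, which covers both indicators; elsewhere it is at least 1 and only the
    inversion indicator can be nonzero. *)
Lemma degree_length_term a x : (pos `\` pos_J) a ->
  (pos `\` pos_J) x -> ~ (pos `\` pos_J) (s a x) ->
  0 <= form x a^v - `[< inv (s a) x >]%:R - (x == a)%:R.
Proof.
move=> Na Nx Nsx; have [x1 _] := nonparabolic_moved_dot Na Nx Nsx.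
have [->|_] := eqVneq x a.
  rewrite dot_corootK ?(root_neq0 hPhi (pos_root Na.1)) //.
  by case: `[< _ >] => /=; lra.
by case: `[< _ >] => /=; lra.
Qed.

End Length.

(** * The inequality and the equivalences *)

Unset Implicit Arguments.

Theorem theorem6p1 (R : realType) (V : vectType R) (form : {dot V for idfun})
    (Phi : set V) (n : nat) (Delta : n.-tuple V) (J : {set 'I_n})
    (hPhi : root_system form Phi) (hDelta : simple_roots Phi Delta)
    (alpha : V)
    (halpha : (pos_roots Phi Delta `\` pos_rootsP Phi Delta J) alpha) :
  let Rpos := pos_roots Phi Delta in
  let RposP := pos_rootsP Phi Delta J in
  let s := refl form alpha in
  let len := (coset_length Phi Delta J s)%:R : R in
  let deg := form (c1 Phi Delta J) (coroot form alpha) in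
  let condA := cosmall form Phi Delta J alpha in
  let condB := len = deg - 1 in
  let condC :=
    (Rpos `\` RposP) `&` (s @` RposP) = set0 /\
    (forall gamma,
       (inversions Phi Delta s `\` (RposP `|` [set alpha])) gamma ->
       form gamma (coroot form alpha) = 1) in
  len <= deg - 1 /\ (condA <-> condB) /\ (condB <-> condC).
Proof.
move=> Rpos RposP s len deg condA condB condC.
have alpha0 : alpha != 0 by apply: (root_neq0 hPhi); case: halpha => -[].
have [M [inM defect]] := degree_length_sum hPhi hDelta halpha.
rewrite -/s -/deg -/len in inM defect.
have term_ge0 x : x \in M ->
    0 <= form x (coroot form alpha) - `[< inversions Phi Delta s x >]%:R - (x == alpha)%:R.
  by move=> /inM[Nx Nsx]; apply: (degree_length_term hPhi hDelta halpha Nx Nsx).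
(* Condition (b) says that a sum of nonnegative terms is 0, so it holds exactly when every term
   vanishes. *)
have BC : condB <-> condC.
  split=> [B|[disj one]].
    have : \sum_(x <- M) (form x (coroot form alpha) -
        `[< inversions Phi Delta s x >]%:R - (x == alpha)%:R) == 0.
      by rewrite -defect -B subrr.
    rewrite big_seq_cond psumr_eq0 => [/allP M0|x /andP[/term_ge0 //]].
    have {}M0 x : x \in M -> form x (coroot form alpha) =
        `[< inversions Phi Delta s x >]%:R + (x == alpha)%:R.
      by move=> xM; have := M0 x xM; rewrite xM /= subr_eq0 subr_eq addrC => /eqP.
    split=> [|g [Ig]].
      apply/seteqP; split=> // x [Nx [d Jd Ed]].
      have Esx : s x = d by rewrite -Ed /s reflK.
      have xM : x \in M by apply/inM; split=> //; rewrite Esx => -[].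
      have := M0 x xM; move/inM: xM => [_ Nsx].
      have [x1 _] := nonparabolic_moved_dot hPhi hDelta halpha Nx Nsx.
      (* Here s(x) is in R_P^+, so x is neither an inversion nor [alpha]; its term is the pairing
         itself, which is at least 1. *)
      rewrite (_ : `[< _ >] = false); last first.
        by apply/asboolP => -[_]; rewrite Esx; apply: (pos_not_neg hPhi hDelta) Jd.1.
      rewrite (_ : (x == alpha) = false) => [E|]; first by move: x1; rewrite E /=; lra.
      apply/eqP => xa; apply: (pos_not_neg hPhi hDelta halpha.1).
      by rewrite -(refl_self form alpha0) -/s -xa Esx; exact: Jd.1.
    move=> /not_orP[nJ /eqP/negPf ga].
    have gM : g \in M.
      by apply/inM; case: Ig => pg psg; split=> // -[/(pos_not_neg hPhi hDelta)].
    by rewrite M0 // ga addr0 (_ : `[< _ >] = true) //; apply/asboolP.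
  have : \sum_(x <- M) (form x (coroot form alpha) -
      `[< inversions Phi Delta s x >]%:R - (x == alpha)%:R) = 0.
    rewrite big_seq; apply: big1 => x /inM[Nx Nsx].
    have [_ []] := nonparabolic_moved_dot hPhi hDelta halpha Nx Nsx => [Ix|Jsx]; last first.
      have : (set0 : set V) x by rewrite -disj; split=> //; exists (s x) => //; rewrite /s reflK.
      by [].
    rewrite (_ : `[< _ >] = true); last exact/asboolP.
    have [->|xa] := eqVneq x alpha; first by rewrite dot_corootK //=; lra.
    rewrite one ?subrr ?subr0 //; split=> // -[]; first exact: Nx.2.
    by apply/eqP.
  by rewrite -defect => /eqP; rewrite subr_eq0 => /eqP.
split; first by rewrite -subr_ge0 defect big_seq sumr_ge0.
split=> //; rewrite BC; split=> [A|[disj one]].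
  split=> [|g [Ig /not_orP[nJ ga]]].
    apply/seteqP; split=> // x [[px nJ] [d Jd Ed]].
    (* Outside [J] the coordinates of s(d) are -(d, alpha^v) times those of [alpha], hence not
       positive by dominance. *)
    have [i iJ xi] := nonparabolic_coord hDelta (conj px nJ).
    have /(pos_rootsPP hDelta)[_ /(_ i iJ) di] := Jd.
    move: xi; rewrite -Ed coord_refl di sub0r oppr_gt0 ltNge.
    rewrite mulr_ge0 ?(cosmall_dominant hPhi hDelta A Jd) //.
    exact: (pos_coord_ge0 hDelta i halpha.1).
  by case: Ig => pg psg; apply: (cosmall_inversion hPhi hDelta A (conj pg nJ) ga psg).
apply: (cosmallI hPhi hDelta halpha) => [d Jd|g Ng ga psg|g Ng Jsg].
(* If (d, alpha^v) < 0, then s(d) has a positive coordinate outside [J], against disjointness. *)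
- rewrite leNgt; apply/negP => da.
  have [i iJ ai] := nonparabolic_coord hDelta halpha.
  have /(pos_rootsPP hDelta)[pd /(_ i iJ) di] := Jd.
  have : (set0 : set V) (s d).
    rewrite -disj; split; last by exists d.
    apply: (nonparabolic_of_coord hDelta (i := i)) => //.
      exact: (root_refl hPhi (pos_root halpha.1) (pos_root pd)).
    by rewrite coord_refl di sub0r oppr_gt0 nmulr_rlt0.
  by [].
- apply: one; split=> [|[]]; [by split=> //; exact: Ng.1|exact: Ng.2|exact: ga].
- have : (set0 : set V) g by rewrite -disj; split=> //; exists (s g) => //; rewrite /s reflK.
  by [].
Qed.
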